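(* For any integers $k>l\ge 2$, as $n\to\infty$, $$ex(n,C_{2l+1},\{C_3,C_4,\dots,C_{2l}\}\cup\{C_{2k}\})=\Omega(n^{1+\frac{1}{2k+1}})\quad\text{and}\quad ex(n,C_{2l+1},\{C_3,C_4,\dots,C_{2l}\}\cup\{C_{2k}\})=O(n^{1+\frac{l}{l+1}}).$$
   Context: $C_k$ denotes the cycle with $k$ vertices. For a graph $H$ and a family of graphs $\mathcal F$, $ex(n,H,\mathcal F)$ is the maximum number of subgraphs isomorphic to $H$ in an $n$-vertex graph containing no member of $\mathcal F$ as a subgraph. *)

(* Defs.v *)
From mathcomp Require Import all_boot.
Set Implicit Arguments. Unset Strict Implicit. Unset Printing Implicit Defensive.

Definition simple_graph (n : nat) (g : {set 'I_n * 'I_n}) : bool :=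
  [forall x : 'I_n, (x, x) \notin g] &&
  [forall x : 'I_n, forall y : 'I_n, ((x, y) \in g) ==> ((y, x) \in g)].

Definition cycle_emb (n m : nat) (g : {set 'I_n * 'I_n}) (f : {ffun 'I_m -> 'I_n}) : bool :=
  injectiveb f && [forall i : 'I_m, (f i, f (ordS i)) \in g].

(* g contains C_m as a subgraph (m >= 3 in all uses). *)
Definition has_cycle (n m : nat) (g : {set 'I_n * 'I_n}) : bool :=
  [exists f : {ffun 'I_m -> 'I_n}, cycle_emb g f].

Definition cycle_edges (n m : nat) (f : {ffun 'I_m -> 'I_n}) : {set {set 'I_n}} :=
  [set [set f i; f (ordS i)] | i : 'I_m].

(* Number of subgraphs of g isomorphic to C_m: a cycle subgraph has no isolated
   vertices, so it is determined by its edge set. *)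
Definition num_cycles (n m : nat) (g : {set 'I_n * 'I_n}) : nat :=
  #|[set cycle_edges f | f in [pred f : {ffun 'I_m -> 'I_n} | cycle_emb g f]]|.

Definition forbidden (l k m : nat) : bool := ((3 <= m <= 2 * l) || (m == 2 * k)).

Definition free_of (l k n : nat) (g : {set 'I_n * 'I_n}) : bool :=
  [forall m : 'I_(2 * k).+1, forbidden l k m ==> ~~ has_cycle m g].

Definition ex_odd_cycle (l k n : nat) : nat :=
  \max_(g : {set 'I_n * 'I_n} | simple_graph g && free_of l k g) num_cycles (2 * l + 1) g.

(* Main.v *)
Require Import Defs.
From Stdlib Require Import Reals Lra Lia.
From mathcomp Require all_boot zify.

(** Upper bound.  Put m = 2l+1.  Averaging over maps c from the vertices to Z/m,
    it suffices to bound the family of labelled m-cycles f with c(f i) = i.  Since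
    there are no even cycles of length at most 2l, a path of length at most l whose
    colours increase by one is determined by its ends.  For a root x of colour r,
    let B(x) be the graph of edges zy where z ends such a path of length l from x
    and y has the next colour.  A subgraph of B(x) of large minimum degree contains
    an alternating path of length 2(k-l) between two vertices z, z' lying in
    different branches at x, which closes up to a 2k-cycle; so B(x) is the union of
    a graph with bounded degrees at the z's and one with bounded degrees at the
    y's, and has O(n) edges.  The edge of a cycle opposite to its vertex x lies in
    B(x).  Let n be of order D^(l+1).  Fix a colour j and take x to be the vertex
    opposite to the edge (f j, f(j+1)).  Among the cycles for which this edge has
    few partners y, those with deg (f j) > D number O(n D^l), because each B(x)
    has O(n) edges.  Among the others, discard the O(n D^l) cycles whose vertex
    f(j+1) lies on few cycles; then f j has at most D successors f(j+1), because
    each B(f j) has O(n) edges.  Doing this for all j leaves families in which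
    every vertex has at most D successors, and these have O(n D^l) members.

    Lower bound.  Take a graph of maximum degree at most Delta, each of whose edges
    is paid for by an m-cycle, with the largest number of m-cycles.  If more than
    m (Delta+1)^(2k) vertices had degree at most Delta - 2, an m-cycle could be
    added on such vertices at pairwise distance more than 2k, and a short cycle
    using both old and new edges would join two of these vertices by a short old
    path.  Hence most vertices have degree about Delta, with Delta of order
    n^(1/(2k+1)). *)

Module GenTuran.
Import all_boot zify.
Set Implicit Arguments. Unset Strict Implicit. Unset Printing Implicit Defensive.

(** * Upper bound *)

Section LevelPaths.
Variables (V : finType) (e : rel V).
Hypothesis esym : symmetric e.

Definition cyc (m : nat) : Prop := exists h : nat -> V,
  [/\ forall i j, i < m -> j < m -> h i = h j -> i = j,
      forall i, i.+1 < m -> e (h i) (h i.+1)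
    & e (h m.-1) (h 0)].

Definition level_path (lev : V -> nat) (a b : nat) (p : nat -> V) : Prop :=
  (forall i, a <= i <= b -> lev (p i) = i) /\
  (forall i, a <= i < b -> e (p i) (p i.+1)).

Lemma level_path_sub lev a b a' b' p :
  a <= a' -> b' <= b -> level_path lev a b p -> level_path lev a' b' p.
Proof. by move=> ha hb [h1 h2]; split=> i hi; [apply: h1 | apply: h2]; lia. Qed.

(** Going up [p] and back down [q] is a closed walk. The levels tell its vertices apart, except for
    two at the same level, one on each path, which differ by hypothesis. *)
Lemma diamond lev p q a b :
  a.+1 < b -> level_path lev a b p -> level_path lev a b q ->
  p a = q a -> p b = q b -> (forall i, a < i < b -> p i <> q i) ->
  cyc (2 * (b - a)).
Proof.
move=> hab [lp ep] [lq eq] pqa pqb pqN.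
pose h t := if t <= b - a then p (a + t) else q (a + 2 * (b - a) - t).
have lh t : t < 2 * (b - a) ->
    lev (h t) = if t <= b - a then a + t else a + 2 * (b - a) - t.
  by move=> ht; rewrite /h; case: ifP => htb; [apply: lp | apply: lq]; lia.
have hlt i j : i < j -> j < 2 * (b - a) -> h i = h j -> False.
  move=> hij hj hE; have := lh i ltac:(lia); rewrite hE lh //.
  case: ifP => hjb; case: ifP => hib; try lia.
  move=> hji; move: hE; rewrite /h hib hjb hji; apply: pqN; lia.
exists h; split.
- move=> i j hi hj hE; case: (ltngtP i j) => // hij.
    by case: (hlt i j).
  by case: (hlt j i).
- move=> i hi; rewrite /h; case: (leqP i.+1 (b - a)) => h1.
    by rewrite ifT ?addnS; [apply: ep; lia | lia].
  case: (leqP i (b - a)) => h2.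
    have -> : a + i = b by lia.
    rewrite pqb esym; have -> : b = (a + 2 * (b - a) - i.+1).+1 by lia.
    have -> : a + 2 * ((a + 2 * (b - a) - i.+1).+1 - a) - i.+1 = a + 2 * (b - a) - i.+1 by lia.
    apply: eq; lia.
  rewrite esym.
  have -> : a + 2 * (b - a) - i = (a + 2 * (b - a) - i.+1).+1 by lia.
  apply: eq; lia.
- rewrite /h /= ifF; last lia.
  rewrite addn0 pqa esym.
  have -> : a + 2 * (b - a) - (2 * (b - a)).-1 = a.+1 by lia.
  apply: eq; lia.
Qed.

(** Boolean form of the existence of a level path from [x], so that [frontier] can be a finite
    set. *)
Fixpoint reach (lev : V -> nat) (x : V) (i : nat) (v : V) : bool :=
  if i is j.+1 then [exists u, reach lev x j u && e u v] && (lev v == i)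
  else (v == x) && (lev v == 0).

Lemma reachP lev x i v :
  reflect (exists p, [/\ level_path lev 0 i p, p 0 = x & p i = v]) (reach lev x i v).
Proof.
apply: (iffP idP).
  elim: i v => [|i IH] v /=.
    case/andP=> /eqP -> /eqP hl; exists (fun _ => x); split=> //; split=> t ht; last by lia.
    by rewrite hl; lia.
  case/andP=> /existsP[u /andP[/IH[p [[h1 h2] p0 pi]] euv]] /eqP hl.
  exists (fun t => if t <= i then p t else v); split=> //; last by rewrite ltnn.
  split=> t ht; first by case: ifP => hti; [apply: h1; lia | have -> : t = i.+1 by lia].
  case: (leqP t.+1 i) => hti; first by rewrite ifT; [apply: h2; lia | lia].
  by have -> : t = i; [lia | rewrite leqnn pi].
case=> p [[h1 h2] p0 <-]; elim: i h1 h2 => [|i IH] h1 h2 /=.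
  by rewrite p0 eqxx -p0 h1.
rewrite h1 ?leqnn // eqxx andbT; apply/existsP; exists (p i); rewrite h2 ?leqnn // andbT.
by apply: IH => t ht; [apply: h1 | apply: h2]; lia.
Qed.

Definition outs (E : {set V * V}) (z : V) := [set y | (z, y) \in E].
Definition ins (E : {set V * V}) (y : V) := [set z | (z, y) \in E].

Lemma two_fresh (N : {set V}) (w : nat -> V) t : t.+2 < #|N| ->
  exists u v, [/\ u \in N, v \in N, u != v &
    forall i, i <= t -> w i <> u /\ w i <> v].
Proof.
move=> hN; pose I := [set w (i : 'I_t.+1) | i : 'I_t.+1].
have hI : #|I| <= t.+1 by rewrite -[X in _ <= X]card_ord; apply: leq_imset_card.
have h1 : 1 < #|N :\: I|.
  by rewrite cardsD; have := subset_leq_card (subsetIr N I); lia.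
case/card_gt1P: h1 => u [v [uN vN uv]]; exists u, v.
move: uN vN; rewrite !inE => /andP[uI uN] /andP[vI vN]; split=> // i hi.
by split=> wi; [move/negP: uI | move/negP: vI]; apply; rewrite -wi;
  apply/imsetP; exists (Ordinal (hi : i < t.+1)).
Qed.

(** The set [E] is read as a bipartite graph: even positions lie on the first side, odd ones on the
    second. *)
Definition zigzag (E : {set V * V}) (z : V) t (w : nat -> V) : Prop :=
  [/\ w 0 = z, forall i j, i <= t -> j <= t -> w i = w j -> i = j
    & forall i, i < t -> (if odd i then (w i.+1, w i) else (w i, w i.+1)) \in E].

Lemma zigzag_rcons E z t w u : zigzag E z t w ->
  (forall i, i <= t -> w i <> u) ->
  (if odd t then (u, w t) else (w t, u)) \in E ->
  zigzag E z t.+1 (fun i => if i <= t then w i else u).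
Proof.
case=> w0 winj wE hu hE; split=> //.
  move=> i j hi hj; case: ifP => h1; case: ifP => h2 //; try (by lia).
  - exact: winj.
  - by move/hu: h1.
  - by move=> E1; move/hu: h2; rewrite E1.
move=> i hi; have -> : i <= t by lia.
case: (leqP i.+1 t) => h1; first by apply: wE.
by have -> : i = t by lia.
Qed.

(** Greedy extension: the current end has more neighbours than there are visited vertices. *)
Lemma exists_zigzag (E : {set V * V}) z y t :
  (z, y) \in E ->
  (forall z y, (z, y) \in E -> t.+3 <= #|outs E z|) ->
  (forall z y, (z, y) \in E -> t.+3 <= #|ins E y|) ->
  exists w, zigzag E z t w.
Proof.
move=> hzy ho hi.
have: forall s, s <= t -> exists w, zigzag E z s w; last by apply.
elim=> [|s IH] hs; first by exists (fun _ => z); split=> // i j; lia.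
case: (IH (ltnW hs)) => w hw; case: (hw) => w0 winj wE.
pose N := if odd s then ins E (w s) else outs E (w s).
have hN : t.+3 <= #|N|.
  rewrite /N; case: s hs w hw w0 winj wE @N {IH} => [|s] hs w hw w0 winj wE N /=.
    by rewrite w0; apply: ho hzy.
  have := wE s (ltnSn _); case: (odd s) => /= h; [exact: ho h | exact: hi h].
have [|u [v [uN _ _ huv]]] := @two_fresh N w s; first lia.
exists (fun i => if i <= s then w i else u); apply: zigzag_rcons => //.
  by move=> i /huv[].
by move: uN; rewrite /N; case: (odd s); rewrite inE.
Qed.

Variable l : nat.
Hypothesis no_short : forall d, 1 < d <= l -> ~ cyc (2 * d).

(** Strong induction on the length. If the paths meet strictly inside, split there; otherwise
    [diamond] gives an even cycle of length at most [2 * l], unless there is no interior level. *)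
Lemma level_path_uniq lev p q a b :
  b <= a + l -> level_path lev a b p -> level_path lev a b q ->
  p a = q a -> p b = q b -> forall i, a <= i <= b -> p i = q i.
Proof.
have [w] := ubnP (b - a); elim: w => // w IH in a b *; move=> hw hl lp lq pqa pqb i hi.
case: (boolP [exists j : 'I_b, (a < j) && (p j == q j)]) => [|/existsPn hN].
  case/existsP=> j /andP[haj /eqP pqj]; have hj := ltn_ord j.
  case: (leqP i j) => hij.
    by apply: (IH a j) => //; try lia; [apply: level_path_sub lp | apply: level_path_sub lq]; lia.
  by apply: (IH j b) => //; try lia; [apply: level_path_sub lp | apply: level_path_sub lq]; lia.
case: (ltnP a.+1 b) => hab.
  case: (@no_short (b - a)); first lia.
  apply: diamond lp lq pqa pqb _ => // t /andP[h1 h2].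
  by move/eqP=> ht; move: (hN (Ordinal h2)) => /=; rewrite h1 ht.
by have [->|->] : i = a \/ i = b by lia.
Qed.

Definition frontier (lev : V -> nat) (x : V) : {set V * V} :=
  [set zy | [&& reach lev x l zy.1, e zy.1 zy.2 & lev zy.2 == l.+1]].

Variable k : nat.
Hypotheses (l_gt1 : 1 < l) (l_lt_k : l < k).
Hypothesis no_long : ~ cyc (2 * k).

Lemma frontier_sparse lev x (E : {set V * V}) :
  E \subset frontier lev x -> E != set0 ->
  (forall z y, (z, y) \in E -> 2 * k + 2 <= #|outs E z|) ->
  (forall z y, (z, y) \in E -> 2 * k + 2 <= #|ins E y|) -> False.
Proof.
move=> sE /set0Pn[[z0 y0] hzy] ho hi.
have Efr z y : (z, y) \in E -> [/\ reach lev x l z, e z y & lev y = l.+1].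
  by move/(subsetP sE); rewrite inE /= => /and3P[-> -> /eqP].
have [/reachP[p [lp p0 pl]] _ _] := Efr _ _ hzy.
(* With one more edge to [u] the zigzag has [2 * (k - l)] edges, and two level paths of length [l]
   bring the cycle to [2 * k]. As [t] is odd, [w t] is on the second side and [u] is again the end
   of a level path. *)
pose t := 2 * (k - l) - 1.
have [||w hw] := @exists_zigzag E z0 y0 t hzy.
- by move=> z y /ho; rewrite /t; lia.
- by move=> z y /hi; rewrite /t; lia.
have ot : odd t by rewrite /t; lia.
have tE : t = t.-1.+1 by rewrite /t; lia.
have hN : t.+2 < #|ins E (w t)|.
  case: hw => _ _ /(_ t.-1); rewrite -tE leqnn => /(_ isT).
  have -> : odd t.-1 = false by lia.
  by move/hi; rewrite /t; lia.
have [u [q [huE hu lq q0 [ql pq1]]]] : exists u q, [/\ (u, w t) \in E,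
    forall i, i <= t -> w i <> u, level_path lev 0 l q, q 0 = x & q l = u /\ p 1 <> q 1].
  (* Of two fresh neighbours of [w t], at least one has a level path leaving [x] by a vertex other
     than [p 1]. *)
  have [u [v [uN vN uv huv]]] := two_fresh w hN.
  move: uN vN; rewrite !inE => uN vN.
  have [/reachP[q [lq q0 ql]] eu _] := Efr _ _ uN.
  have [/reachP[r [lr r0 rl]] ev ly] := Efr _ _ vN.
  case: (p 1 =P q 1) => [pq|]; last first.
    by exists u, q; split=> // i /huv[].
  exists v, r; split=> //; first by move=> i /huv[].
  split=> // pr.
  (* If both paths started with [p 1], their extensions to [w t] would agree at levels 1 and
     [l + 1], hence also at level [l], forcing [u = v]. *)
  pose q' i := if i <= l then q i else w t; pose r' i := if i <= l then r i else w t.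
  have ext (s : nat -> V) : level_path lev 0 l s -> e (s l) (w t) ->
      level_path lev 1 l.+1 (fun i => if i <= l then s i else w t).
    case=> s1 s2 es; split=> i hir.
      by case: ifP => hil; [apply: s1; lia | have -> : i = l.+1 by lia].
    case: (leqP i.+1 l) => h1; first by rewrite ifT; [apply: s2; lia | lia].
    by have -> : i = l; [lia | rewrite leqnn].
  have := @level_path_uniq lev q' r' 1 l.+1 _ (ext q lq _) (ext r lr _) _ _ l.
  rewrite /q' /r' !ltnn leqnn ql rl (ltnW l_gt1) -pq pr.
  move/(_ ltac:(lia) eu ev erefl erefl ltac:(lia)).
  by move/eqP; rewrite (negPf uv).
(* A common vertex at level [i] would make [p] and [q] agree from level 0 to [i], in particular at
   level 1. *)
have pq i : 0 < i <= l -> p i <> q i.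
  move=> hil pqi; apply: pq1.
  apply: (@level_path_uniq lev p q 0 i) => //; try lia; try (by rewrite p0 q0).
    by apply: level_path_sub lp; lia.
  by apply: level_path_sub lq; lia.
have := zigzag_rcons hw hu; rewrite ot => /(_ huE).
set w' := (fun i => _) => hw'.
have w't : w' t.+1 = u by rewrite /w' ltnn.
have [w'0 w'inj w'E] := hw'.
have tS : t.+1 = 2 * (k - l) by rewrite /t; lia.
have lw i : i <= t.+1 -> lev (w' i) = l + odd i.
  have levz z y : (z, y) \in E -> lev z = l /\ lev y = l.+1.
    case/Efr=> /reachP[s [[ls _] _ <-]] _ ->; rewrite ls //; lia.
  case: i => [|i] hit; first by rewrite w'0; have [-> _] := levz _ _ hzy; rewrite addn0.
  by have := w'E i hit => /=; case: (odd i) => /levz[h1 h2] /=; rewrite ?h1 ?h2; lia.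
have ew i : i <= t -> e (w' i) (w' i.+1).
  by move=> hit; have := w'E i hit; case: (odd i) => /Efr[_ h _]; rewrite // esym.
case: lp lq => lp ep [lq eq].
pose h i := if i < l then p i else if i <= l + t.+1 then w' (i - l) else q (2 * k - i).
apply: no_long; exists h.
have lh i : i < 2 * k -> lev (h i) = if i < l then i else if i <= l + t.+1 then
    l + odd (i - l) else 2 * k - i.
  move=> hik; rewrite /h; case: ifP => h1; first by apply: lp; lia.
  by case: ifP => h2; [apply: lw; lia | apply: lq; lia].
(* Levels below [l] occur at most once on each of [p] and [q], kept apart by [pq]; levels [l] and
   [l + 1] occur only on the injective zigzag. *)
have hlt i j : i < j -> j < 2 * k -> h i = h j -> False.
  move=> hij hjk hE; have := lh i ltac:(lia); rewrite hE lh //; move: hE; rewrite /h.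
  case: (ltnP i l) => h1; case: (ltnP j l) => h2; try lia.
    case: (leqP j (l + t.+1)) => h3; first by lia.
    move=> hE hji; move: hE; rewrite hji; apply: pq; lia.
  case: (leqP j (l + t.+1)) => h3; case: (leqP i (l + t.+1)) => h4; try lia.
  by move/w'inj; lia.
split.
- move=> i j hi' hj hE; case: (ltngtP i j) => // hij.
    by case: (hlt i j).
  by case: (hlt j i).
- move=> i hik; rewrite /h; case: (ltnP i.+1 l) => h1.
    by rewrite ifT; [apply: ep; lia | lia].
  case: (ltnP i l) => h2.
    rewrite ifT; last lia.
    have -> : i.+1 = l by lia.
    by rewrite subnn w'0 -pl; have -> : l = i.+1; [lia | apply: ep; lia].
  case: (leqP i.+1 (l + t.+1)) => h3.
    by rewrite ifT; [rewrite subSn //; apply: ew; lia | lia].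
  case: (leqP i (l + t.+1)) => h4.
    have -> : i - l = t.+1 by lia.
    have hqi : 2 * k - i = l by lia.
    rewrite w't -ql; have -> : 2 * k - i.+1 = l.-1 by lia.
    rewrite esym; have {2}-> : l = l.-1.+1 by lia.
    by apply: eq; lia.
  rewrite esym; have -> : 2 * k - i = (2 * k - i.+1).+1 by lia.
  by apply: eq; lia.
- rewrite /h /= ifF; last lia. rewrite ifF; last lia.
  rewrite ifT; last lia.
  by have -> : 2 * k - (2 * k).-1 = 1; [lia | rewrite p0 -q0 esym; apply: eq; lia].
Qed.

End LevelPaths.

(** * Counting by fibres *)

Section Fibers.
Variables (T U : finType) (A : {set T}) (S : {set U}) (g : T -> U) (b : nat).

Lemma card_fibers : #|A| = \sum_(x : U) #|[set a in A | g a == x]|.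
Proof.
rewrite -sum1_card (partition_big g predT) //=; apply: eq_bigr => x _.
by rewrite -sum1_card; apply: eq_bigl => a; rewrite inE.
Qed.

Lemma card_fiber_le : (forall a, a \in A -> g a \in S) ->
  (forall x, x \in S -> #|[set a in A | g a == x]| <= b) -> #|A| <= #|S| * b.
Proof.
move=> hS hb; rewrite card_fibers (bigID (mem S)) /= [X in _ + X]big1 => [|x xS].
  by rewrite addn0 -sum_nat_const; apply: leq_sum.
apply/eqP; rewrite cards_eq0; apply/eqP/setP=> a; rewrite !inE.
by apply/andP=> -[/hS gS /eqP gx]; rewrite -gx gS in xS.
Qed.

Lemma card_fiber_ge :
  (forall x, x \in S -> b <= #|[set a in A | g a == x]|) -> #|S| * b <= #|A|.
Proof.
move=> hb; rewrite card_fibers (bigID (mem S)) /= -sum_nat_const.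
by apply: leq_trans (leq_addr _ _); apply: leq_sum.
Qed.

End Fibers.

Lemma card_in_le (T U : finType) (A : {set T}) (B : {set U}) (g : T -> U) :
  {in A &, injective g} -> (forall a, a \in A -> g a \in B) -> #|A| <= #|B|.
Proof.
move=> gi gB; rewrite -(card_in_imset gi); apply: subset_leq_card.
by apply/subsetP=> _ /imsetP[a /gB h ->].
Qed.

(** * Splitting a degenerate bipartite graph *)

Section Degeneracy.
Variables (V : finType) (C : nat).
Implicit Types E : {set V * V}.

(** Peel off all edges at a vertex of degree below [C] and recurse. Edges peeled at a first-side
    vertex go into [E1], those peeled at a second-side vertex stay out of it; a peeled vertex keeps
    no other edge, so its bound persists. *)
Lemma degenerate_split E : 0 < C ->
  (forall E', E' \subset E -> E' != set0 -> exists z y,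
     (z, y) \in E' /\ (#|outs E' z| < C \/ #|ins E' y| < C)) ->
  exists E1, [/\ E1 \subset E, forall z, #|outs E1 z| < C
               & forall y, #|ins (E :\: E1) y| < C].
Proof.
move=> C0; have [w] := ubnP #|E|; elim: w E => // w IH E hw hE.
have [E0|En0] := eqVneq E set0.
  exists set0; split=> [|z|y]; first by rewrite sub0set.
    by rewrite (_ : outs _ _ = set0) ?cards0 //; apply/setP=> y; rewrite !inE.
  by rewrite (_ : ins _ _ = set0) ?cards0 //; apply/setP=> z; rewrite E0 !inE.
have [z [y [zyE hd]]] := hE E (subxx _) En0.
have rec (P : pred (V * V)) : P (z, y) ->
    exists E1, [/\ E1 \subset E :\: [set a | P a], forall z, #|outs E1 z| < C
               & forall y, #|ins ((E :\: [set a | P a]) :\: E1) y| < C].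
  move=> Pzy; apply: IH.
    rewrite -ltnS; apply: leq_trans hw; rewrite ltnS; apply: proper_card.
    by apply/properP; split; [apply: subsetDl | exists (z, y); rewrite ?inE ?Pzy].
  by move=> E' sE'; apply: hE; apply: subset_trans sE' (subsetDl _ _).
case: hd => hd.
- have [E1 [sE1 o1 i1]] := rec [pred a | a.1 == z] (eqxx z).
  exists (E1 :|: [set a in E | a.1 == z]); split.
  + rewrite subUset (subset_trans sE1 (subsetDl _ _)) /=.
    by apply/subsetP=> a; rewrite inE => /andP[].
  + move=> z'; have [->|zz'] := eqVneq z' z.
      apply: leq_ltn_trans hd; apply: subset_leq_card; apply/subsetP=> y'.
      rewrite !inE => /orP[/(subsetP sE1)|/andP[]//].
      by rewrite !inE eqxx.
    apply: leq_ltn_trans (o1 z'); apply: subset_leq_card; apply/subsetP=> y'.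
    by rewrite !inE /= (negPf zz') andbF orbF.
  + move=> y'; apply: leq_ltn_trans (i1 y'); apply: subset_leq_card.
    apply/subsetP=> z'; rewrite !inE /= negb_or => /andP[/andP[-> h] hz'].
    by rewrite hz' andTb /= in h *; rewrite h.
- have [E1 [sE1 o1 i1]] := rec [pred a | a.2 == y] (eqxx y).
  exists E1; split=> //; first exact: subset_trans sE1 (subsetDl _ _).
  move=> y'; have [->|yy'] := eqVneq y' y.
    apply: leq_ltn_trans hd; apply: subset_leq_card; apply/subsetP=> z'.
    by rewrite !inE => /andP[].
  apply: leq_ltn_trans (i1 y'); apply: subset_leq_card; apply/subsetP=> z'.
  by rewrite !inE /= (negPf yy').
Qed.

Lemma card_of_split E E1 : (forall z, #|outs E1 z| < C) ->
  (forall y, #|ins (E :\: E1) y| < C) -> #|E| <= 2 * C * #|V|.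
Proof.
move=> o1 i1.
have h1 : #|E1| <= #|[set: V]| * C.
  apply: (@card_fiber_le _ _ _ _ fst) => [a|z _]; first by rewrite inE.
  apply: leq_trans (ltnW (o1 z)).
  apply: (@card_in_le _ _ _ _ snd) => [[z1 y1] [z2 y2]|[z1 y1]]; rewrite !inE /=.
    by move=> /andP[_ /eqP->] /andP[_ /eqP->] ->.
  by case/andP=> h /eqP <-.
have h2 : #|E :\: E1| <= #|[set: V]| * C.
  apply: (@card_fiber_le _ _ _ _ snd) => [a|y _]; first by rewrite inE.
  apply: leq_trans (ltnW (i1 y)).
  apply: (@card_in_le _ _ _ _ fst) => [[z1 y1] [z2 y2]|[z1 y1]]; rewrite !inE /=.
    by move=> /andP[_ /eqP->] /andP[_ /eqP->] ->.
  by case/andP=> h /eqP <-.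
rewrite cardsT in h1 h2; have := cardsID E1 E; have := subset_leq_card (subsetIr E E1).
by rewrite -mulnA mul2n -addnn [C * _]mulnC; lia.
Qed.

End Degeneracy.

(** * Cyclic indexing *)

Definition at_pos (V : Type) m (m_gt0 : 0 < m) (f : {ffun 'I_m -> V}) (i : nat) : V :=
  f (Ordinal (ltn_pmod i m_gt0)).

Section AtPos.
Variables (V : finType) (m : nat) (m_gt0 : 0 < m).
Implicit Types f : {ffun 'I_m -> V}.

Lemma at_posE f (i : 'I_m) : at_pos m_gt0 f i = f i.
Proof. by congr (f _); apply: val_inj; rewrite /= modn_small. Qed.

Lemma at_pos_eq f i j : i = j %[mod m] -> at_pos m_gt0 f i = at_pos m_gt0 f j.
Proof. by move=> h; congr (f _); apply: val_inj. Qed.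

Lemma at_posDm f i : at_pos m_gt0 f (i + m) = at_pos m_gt0 f i.
Proof. by apply: at_pos_eq; rewrite modnDr. Qed.

Lemma at_posS f i : at_pos m_gt0 f i.+1 = f (ordS (Ordinal (ltn_pmod i m_gt0))).
Proof. by congr (f _); apply: val_inj; rewrite /= -addn1 -[in RHS]addn1 modnDml. Qed.

End AtPos.

(** * Cycles with prescribed colours *)

Section ColouredCycles.
Variables (V : finType) (e : rel V) (l k : nat).
Hypothesis esym : symmetric e.
Hypotheses (l_gt1 : 1 < l) (l_lt_k : l < k).
Hypothesis no_short : forall d, 1 < d <= l -> ~ cyc e (2 * d).
Hypothesis no_long : ~ cyc e (2 * k).
Variable c : V -> nat.

Let m := 2 * l + 1.
Let C := 2 * k + 2.
Let m_gt0 : 0 < m. Proof. by rewrite /m addn1. Qed.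

Notation "f @! i" := (at_pos m_gt0 f i) (at level 30).

Definition coloured : {set {ffun 'I_m -> V}} :=
  [set f : {ffun 'I_m -> V} | [forall i : 'I_m, e (f i) (f (ordS i)) && (c (f i) == i)]].

Lemma coloured_edge f i : f \in coloured -> e (f @! i) (f @! i.+1).
Proof. by rewrite inE at_posS => /forallP/(_ (Ordinal (ltn_pmod i m_gt0)))/andP[]. Qed.

Lemma coloured_col f i : f \in coloured -> c (f @! i) = i %% m.
Proof. by rewrite inE => /forallP/(_ (Ordinal (ltn_pmod i m_gt0)))/andP[_ /eqP]. Qed.

(* (c v - r) mod m, written without truncated subtraction. *)
Definition level (r : nat) (v : V) : nat := (c v + (m - r %% m)) %% m.

Lemma level_at r i f : f \in coloured -> i < m -> level r (f @! (r + i)) = i.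
Proof.
move=> hf him; rewrite /level coloured_col // modnDml.
have hr := ltn_pmod r m_gt0; have := divn_eq r m; move: hr.
move: (r %% m) (r %/ m) => a q ha ->.
have -> : q * m + a + i + (m - a) = i + q.+1 * m by rewrite mulSn; lia.
by rewrite addnC modnMDl modn_small.
Qed.

Lemma coloured_path r f : f \in coloured ->
  level_path e (level r) 0 (2 * l) (fun i => f @! (r + i)).
Proof.
move=> hf; split=> i hi; first by apply: level_at => //; rewrite /m; lia.
by rewrite addnS; apply: coloured_edge.
Qed.

Let fr r x := frontier e l (level r) x.

Lemma coloured_frontier r f : f \in coloured ->
  (f @! (r + l), f @! (r + l).+1) \in fr r (f @! r).
Proof.
move=> hf; rewrite inE /= coloured_edge //= -addnS level_at //; last by rewrite /m; lia.
rewrite eqxx andbT.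
apply/reachP; exists (fun i => f @! (r + i)); rewrite addn0; split=> //.
by apply: level_path_sub (coloured_path r hf); lia.
Qed.

Lemma coloured_agree r f g : f \in coloured -> g \in coloured ->
  f @! r = g @! r -> f @! (r + l) = g @! (r + l) ->
  forall i, i <= l -> f @! (r + i) = g @! (r + i).
Proof.
move=> hf hg h1 h2 i hi.
apply: (@level_path_uniq V e esym l no_short (level r)
  (fun i => f @! (r + i)) (fun i => g @! (r + i)) 0 l) => //; rewrite ?addn0 //.
- by apply: level_path_sub (coloured_path r hf); lia.
- by apply: level_path_sub (coloured_path r hg); lia.
Qed.

(** A vertex and the opposite edge determine the cycle: uniqueness of level paths recovers the two
    arcs of length [l] between them. *)
Lemma coloured_inj r f g : f \in coloured -> g \in coloured ->
  f @! r = g @! r -> f @! (r + l) = g @! (r + l) ->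
  f @! (r + l).+1 = g @! (r + l).+1 -> f = g.
Proof.
move=> hf hg h1 h2 h3.
have A := coloured_agree hf hg h1 h2.
have B : forall i, i <= l -> f @! ((r + l).+1 + i) = g @! ((r + l).+1 + i).
  apply: coloured_agree => //.
  have -> : (r + l).+1 + l = r + m by rewrite /m; lia.
  by rewrite !at_posDm.
have D i : i < m -> f @! (r + i) = g @! (r + i).
  move=> him; case: (leqP i l) => hil; first exact: A.
  have -> : r + i = (r + l).+1 + (i - l.+1) by lia.
  by apply: B; move: him; rewrite /m; lia.
apply/ffunP=> j; rewrite -!(at_posE m_gt0).
have hr := ltn_pmod r m_gt0; have hj := ltn_ord j.
(* The offset of [j] from [r] modulo [m]. *)
pose i := (j + (m - r %% m)) %% m.
have E : j = r + i %[mod m].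
  rewrite /i modnDmr.
  have -> : r + (j + (m - r %% m)) = (r %/ m).+1 * m + j.
    by have := divn_eq r m; rewrite mulSn; move: hr; move: (r %% m) (r %/ m * m); lia.
  by rewrite modnMDl.
by rewrite !(at_pos_eq m_gt0 _ E) D // ltn_pmod.
Qed.

(** By [frontier_sparse], every nonempty part of a frontier has an edge with an end of degree below
    [C], so [degenerate_split] applies; the choice is made for all roots at once. *)
Lemma frontier_split r : exists A : V -> {set V * V}, forall x,
  [/\ A x \subset fr r x, forall z, #|outs (A x) z| < C
    & forall y, #|ins (fr r x :\: A x) y| < C].
Proof.
suff h x : exists A : {set V * V}, [/\ A \subset fr r x,
    forall z, #|outs A z| < C & forall y, #|ins (fr r x :\: A) y| < C].
  by have [A hA] := fin_all_exists h; exists A.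
apply: degenerate_split => [|E sE En]; first by rewrite /C addn2.
case: (boolP [exists a in E, (#|outs E a.1| < C) || (#|ins E a.2| < C)]).
  by case/exists_inP=> -[z y] /= hE /orP h; exists z, y.
move/exists_inPn=> hN; exfalso.
apply: (@frontier_sparse V e esym l no_short k l_gt1 l_lt_k no_long (level r) x E) => //.
  by move=> z y /hN /=; rewrite negb_or -!leqNgt => /andP[].
by move=> z y /hN /=; rewrite negb_or -!leqNgt => /andP[].
Qed.

Lemma card_frontier r x : #|fr r x| <= 2 * C * #|V|.
Proof.
by have [A /(_ x)[_ o i]] := frontier_split r; apply: card_of_split o i.
Qed.

Implicit Types F : {set {ffun 'I_m -> V}}.

Definition fwd F j v := [set f @! j.+1 | f in [set f in F | f @! j == v]].

Lemma fwd_sub F F' j v : F \subset F' -> #|fwd F j v| <= #|fwd F' j v|.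
Proof.
move=> sF; apply: subset_leq_card; apply: imsetS; apply/subsetP=> f.
by rewrite !inE => /andP[/(subsetP sF) -> ->].
Qed.

(** * Bounding the successors at one position *)

Section Step.
Variables (r D : nat) (F : {set {ffun 'I_m -> V}}).
Hypotheses (D_gt0 : 0 < D) (hD : #|V| <= D ^ l.+1) (sF : F \subset coloured).
Variable A : V -> {set V * V}.
Hypothesis hA : forall x,
  [/\ A x \subset fr r x, forall z, #|outs (A x) z| < C
    & forall y, #|ins (fr r x :\: A x) y| < C].

(** In [FA] the vertex at [r] and the first end of the opposite edge leave fewer than [C] choices
    for the second end; in [FB] the two ends exchange roles. *)
Let FA := [set f in F | (f @! (r + l), f @! (r + l).+1) \in A (f @! r)].
Let FB := F :\: FA.

Let nbr v := [set y | e v y & level r y == l.+1].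

Let colF f : f \in F -> f \in coloured. Proof. exact: (subsetP sF). Qed.

(** Each such end contributes more than [D] edges to the frontier of [x], which has at most
    [2 * C * D ^ l.+1]. *)
Lemma card_high_ends x :
  #|[set z | reach e (level r) x l z & D < #|nbr z|]| <= 2 * C * D ^ l.
Proof.
set S := [set z | _]; rewrite -(leq_pmul2r D_gt0) -mulnA -expnSr.
apply: leq_trans (_ : 2 * C * #|V| <= _); last by rewrite leq_mul2l hD orbT.
apply: leq_trans (card_frontier r x).
apply: (@card_fiber_ge _ _ _ _ fst) => z; rewrite inE => /andP[hz /ltnW hd].
apply: leq_trans hd _.
apply: (@card_in_le _ _ _ _ (fun y => (z, y))) => [y y' _ _ []//|y].
by rewrite !inE /= hz eqxx andbT.
Qed.

(** The vertices at [r] and [r + l] form at most [#|V| * (2 * C * D ^ l)] pairs, and fewer than [C]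
    cycles of [FA] share a pair. *)
Lemma card_FA_high :
  #|[set f in FA | D < #|nbr (f @! (r + l))|]| <= 2 * C * C * #|V| * D ^ l.
Proof.
set FAh := [set f in FA | _].
pose S := [set xz : V * V | reach e (level r) xz.1 l xz.2 & D < #|nbr xz.2|].
apply: leq_trans (_ : #|S| * C <= _).
  apply: (@card_fiber_le _ _ _ _ (fun f => (f @! r, f @! (r + l)))).
    move=> f; rewrite inE => /andP[+ h]; rewrite inE => /andP[/colF hf _].
    by have := coloured_frontier r hf; rewrite !inE /= h andbT => /and3P[].
  move=> [x z] _; have [_ /(_ z) hz _] := hA x; apply: leq_trans (ltnW hz).
  apply: (@card_in_le _ _ _ _ (fun f => f @! (r + l).+1)).
    move=> f g; rewrite !inE => /andP[/andP[/andP[/colF hf _] _] /eqP[f1 f2]].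
    move=> /andP[/andP[/andP[/colF hg _] _] /eqP[g1 g2]].
    by apply: (@coloured_inj r); rewrite ?f1 ?f2.
  by move=> f; rewrite !inE => /andP[/andP[/andP[_ h] _] /eqP[<- <-]].
have -> : 2 * C * C * #|V| * D ^ l = #|[set: V]| * (2 * C * D ^ l) * C.
  by rewrite cardsT; lia.
rewrite leq_mul2r; apply/orP; right.
apply: (@card_fiber_le _ _ _ _ fst) => [a|x _]; first by rewrite inE.
apply: leq_trans (card_high_ends x).
apply: (@card_in_le _ _ _ _ snd) => [[x1 z1] [x2 z2]|[x1 z1]]; rewrite !inE /=.
  by move=> /andP[_ /eqP->] /andP[_ /eqP->] ->.
by case/andP=> h /eqP <-.
Qed.

(** The threshold for which [2 * C * C * #|V|] is at most [D * A0]. *)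
Let A0 := 2 * C * C * D ^ l.
Let thru u := [set f in FB | f @! (r + l).+1 == u].

Lemma card_FB_light :
  #|[set f in FB | #|thru (f @! (r + l).+1)| <= A0]| <= #|V| * A0.
Proof.
rewrite -cardsT; set X := [set f in FB | _].
apply: (@card_fiber_le _ _ X _ (fun f => f @! (r + l).+1)) => [a|u _]; first by rewrite inE.
have [->|/set0Pn[f]] := eqVneq [set f in X | f @! (r + l).+1 == u] set0.
  by rewrite cards0.
rewrite !inE => /andP[/andP[_ h] /eqP fu]; rewrite fu in h.
apply: leq_trans h; apply: subset_leq_card; apply/subsetP=> g.
by rewrite !inE => /andP[/andP[-> _] ->].
Qed.

Let FBh := [set f in FB | A0 < #|thru (f @! (r + l).+1)|].

(* Each forward neighbour u of v carries more than A0 cycles, and these extend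
   the edge vu to paths of length l + 1 from v, whose number is linear. *)
Lemma fwd_FBh v : #|fwd FBh (r + l) v| <= D.
Proof.
set T := fwd _ _ _.
have hC : 0 < C by rewrite /C addn2.
have A0_gt0 : 0 < A0 by rewrite /A0 !muln_gt0 hC expn_gt0 D_gt0.
pose G := [set g in FB | g @! (r + l).+1 \in T].
have hG : #|T| * A0 <= #|G|.
  apply: (@card_fiber_ge _ _ _ _ (fun g => g @! (r + l).+1)) => u uT.
  case/imsetP: (uT) => f; rewrite !inE => /andP[/andP[_ /ltnW h] _] uE.
  rewrite uE in uT *; apply: leq_trans h _; apply: subset_leq_card.
  apply/subsetP=> g; rewrite !inE => /andP[-> /eqP ge].
  by rewrite ge uT eqxx.
have hT u : u \in T -> e v u /\ level (r + l) u = 1.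
  case/imsetP=> f; rewrite !inE => /andP[/andP[/andP[_ /colF hf] _] /eqP fv] ->.
  rewrite -fv; split; first exact: coloured_edge.
  by rewrite -addn1 level_at // /m; lia.
have GF g : g \in G -> g \in coloured /\ g @! (r + l).+1 \in T.
  by rewrite inE => /andP[]; rewrite inE => /andP[_ /colF hg].
(* The vertex of [g] at [r + l] is replaced by [v]. The result is still a level path, because [v] is
   adjacent to every vertex of [T]. *)
pose p (g : {ffun 'I_m -> V}) i := if i == 0 then v else g @! (r + l + i).
have vlev u : u \in T -> level (r + l) v = 0.
  case/imsetP=> f; rewrite !inE => /andP[/andP[/andP[_ /colF hf] _] /eqP <-] _.
  by rewrite -[in f @! _](addn0 (r + l)) level_at.
have hp g : g \in G -> level_path e (level (r + l)) 0 l.+1 (p g).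
  case/GF=> hg gT; split=> i hi; rewrite /p.
    case: eqP => [->|_]; first exact: vlev gT.
    by apply: level_at => //; rewrite /m; lia.
  case: i hi => [|i] hi /=; first by rewrite addn1; case: (hT _ gT).
  by rewrite [in X in e _ X]addnS; apply: coloured_edge.
have rm : r + l + l.+1 = r + m by rewrite /m; lia.
(* The last edge [(z, y)] of [p g] fixes the vertex at [r + l + 1], by uniqueness of the level path
   from [v] to [z], and [y] is the vertex at [r]. As [g] is in [FB], fewer than [C] choices remain
   for the vertex at [r + l]. *)
have hG2 : #|G| <= #|fr (r + l) v| * C.
  apply: (@card_fiber_le _ _ _ _ (fun g => (p g l, p g l.+1))).
    move=> g gG; have [h1 h2] := hp g gG.
    rewrite inE /= h2 ?h1 ?eqxx ?andbT ?leqnn //.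
    by apply/reachP; exists (p g); split=> //; apply: level_path_sub (hp g gG).
  move=> [z y] _; have [->|/set0Pn[g0]] := eqVneq [set g in G | (p g l, p g l.+1) == (z, y)] set0.
    by rewrite cards0.
  rewrite inE => /andP[g0G /eqP[g0z g0y]].
  have [_ _ /(_ (g0 @! (r + l).+1)) hy] := hA y.
  apply: leq_trans (ltnW hy).
  have sameU g : g \in G -> p g l = z -> g @! (r + l).+1 = g0 @! (r + l).+1.
    move=> gG gz; have lg : level_path e (level (r + l)) 0 l (p g).
      by apply: level_path_sub (hp g gG).
    have lg0 : level_path e (level (r + l)) 0 l (p g0).
      by apply: level_path_sub (hp g0 g0G).
    have := level_path_uniq esym no_short (leqnn _) lg lg0 erefl.
    rewrite gz g0z => /(_ erefl 1 (ltnW l_gt1)).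
    by rewrite /p /= addn1.
  have gr g : p g l.+1 = y -> g @! r = y by rewrite /p /= rm at_posDm.
  apply: (@card_in_le _ _ _ _ (fun g => g @! (r + l))).
    move=> g g'; rewrite !inE -/(G) => /andP[gG /eqP[gz gy]] /andP[g'G /eqP[g'z g'y]] E.
    have gG2 : g \in G by rewrite !inE.
    have g'G2 : g' \in G by rewrite !inE.
    apply: (@coloured_inj r) => //; first by case: (GF g gG2).
    - by case: (GF g' g'G2).
    - by rewrite !gr.
    - by rewrite !sameU.
  move=> g; rewrite inE => /andP[gG /eqP[gz gy]].
  have [hg _] := GF g gG.
  rewrite !inE -(sameU g gG gz) -{1 2}(gr g gy).
  have := coloured_frontier r hg; rewrite !inE => ->; rewrite andbT.
  move: gG; rewrite !inE => /andP[/andP[h1 h2] _].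
  by move: h1; rewrite h2.
have := leq_mul (card_frontier (r + l) v) (leqnn C).
move/(leq_trans hG2)/(leq_trans hG) => h.
rewrite -(leq_pmul2r A0_gt0); apply: leq_trans h _.
rewrite /A0 (mulnC D) -[_ * D]mulnA -expnSr -(mulnA (2 * C)) (mulnC #|V|) mulnA.
by rewrite leq_mul2l hD orbT.
Qed.

(** [F1] keeps the cycles of [FA] with at most [D] candidates for the next vertex, [F2] those of
    [FB] through heavy vertices. Each of the two discarded families has at most
    [2 * C * C * #|V| * D ^ l] members. *)
Lemma step_fwd : exists F1 F2 : {set {ffun 'I_m -> V}},
  [/\ F1 \subset F, F2 \subset F,
      forall v, #|fwd F1 (r + l) v| <= D, forall v, #|fwd F2 (r + l) v| <= D
    & #|F| <= #|F1| + #|F2| + 4 * C * C * #|V| * D ^ l].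
Proof.
pose FAl := [set f in FA | #|nbr (f @! (r + l))| <= D].
exists FAl, FBh; split.
- by apply/subsetP=> f; rewrite !inE => /andP[/andP[]].
- by apply/subsetP=> f; rewrite !inE => /andP[/andP[]].
- move=> v; have [->|/set0Pn[u]] := eqVneq (fwd FAl (r + l) v) set0; first by rewrite cards0.
  case/imsetP=> f; rewrite !inE => /andP[/andP[_ h] /eqP fv] _; rewrite fv in h.
  apply: leq_trans h; apply: subset_leq_card; apply/subsetP=> _ /imsetP[g + ->].
  rewrite !inE => /andP[/andP[/andP[/colF hg _] _] /eqP <-].
  rewrite coloured_edge //= -addnS level_at // /m; lia.
- exact: fwd_FBh.
- have h1 := cardsID FA F; have h2 := card_FA_high; have h3 := card_FB_light.
  have h4 : #|F :&: FA| <= #|FAl| + #|[set f in FA | D < #|nbr (f @! (r + l))|]|.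
    rewrite -cardsUI; apply: leq_trans (leq_addr _ _); apply: subset_leq_card.
    apply/subsetP=> f; rewrite !inE => /andP[_ /andP[-> ->]] /=.
    by rewrite ltnNge orbN.
  have h5 : #|FB| <= #|FBh| + #|[set f in FB | #|thru (f @! (r + l).+1)| <= A0]|.
    rewrite -cardsUI; apply: leq_trans (leq_addr _ _); apply: subset_leq_card.
    apply/subsetP=> f hf; rewrite in_setU; apply/orP.
    by case: (leqP #|thru (f @! (r + l).+1)| A0) => h; [right | left]; rewrite in_set hf.
  move: h1 h2 h3 h4 h5; rewrite /A0 -/FB.
  have -> : #|V| * (2 * C * C * D ^ l) = 2 * C * C * #|V| * D ^ l by lia.
  have -> : 4 * C * C * #|V| * D ^ l = 2 * (2 * C * C * #|V| * D ^ l) by lia.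
  lia.
Qed.

End Step.

Lemma card_iter_fwd F D r i : (forall j v, #|fwd F j v| <= D) ->
  forall x, #|[set f @! (r + i) | f in [set f in F | f @! r == x]]| <= D ^ i.
Proof.
move=> hd x; elim: i => [|i IH].
  rewrite expn0 -(cards1 x); apply: subset_leq_card.
  by apply/subsetP=> _ /imsetP[f + ->]; rewrite !inE addn0 => /andP[].
set S := [set f @! (r + i) | f in _] in IH.
apply: leq_trans (_ : #|\bigcup_(v in S) fwd F (r + i) v| <= _).
  apply: subset_leq_card; apply/subsetP=> _ /imsetP[f hf ->].
  apply/bigcupP; exists (f @! (r + i)); first exact: imset_f.
  by rewrite addnS; apply: imset_f; move: hf; rewrite !inE eqxx andbT => /andP[].
apply: leq_trans (_ : \sum_(v in S) D <= _).
  have := leq_card_setU; elim/big_ind2: _ => [|n1 B1 n2 B2 h1 h2 hU|v _ _] //.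
    by rewrite cards0.
  by apply: leq_trans (hU _ _ _) _; apply: leq_add; [apply: h1 | apply: h2].
by rewrite sum_nat_const expnSr leq_mul2r IH orbT.
Qed.

(** At most [#|V| * D ^ l] pairs of vertices occur at two given positions [l] apart. Depending on
    [A], either the pair at [0] and [l] or the pair at [l + 1] and [2 * l + 1] leaves fewer than [C]
    cycles. *)
Lemma card_bounded_fwd D F : F \subset coloured ->
  (forall j v, #|fwd F j v| <= D) -> #|F| <= 2 * C * #|V| * D ^ l.
Proof.
move=> sF hd; have [A hA] := frontier_split 0.
have colF f : f \in F -> f \in coloured by apply: (subsetP sF).
pose FA := [set f in F | (f @! l, f @! l.+1) \in A (f @! 0)].
pose ends r := [set (f @! r, f @! (r + l)) | f in F].
have hends r : #|ends r| <= #|V| * D ^ l.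
  rewrite -cardsT; apply: (@card_fiber_le _ _ _ _ fst) => [a|x _]; first by rewrite inE.
  apply: leq_trans (card_iter_fwd r l hd x).
  apply: (@card_in_le _ _ _ _ snd) => [[x1 z1] [x2 z2]|[x1 z1]]; rewrite !inE /=.
    by move=> /andP[_ /eqP->] /andP[_ /eqP->] ->.
  case/andP=> /imsetP[f hf [-> ->]] /eqP <-; apply: imset_f.
  by rewrite inE hf eqxx.
have h1 : #|FA| <= #|ends 0| * C.
  apply: (@card_fiber_le _ _ _ _ (fun f => (f @! 0, f @! (0 + l)))).
    by move=> f; rewrite inE => /andP[hf _]; apply: (imset_f (fun f => (f @! 0, f @! (0 + l)))).
  move=> [x z] _; have [_ /(_ z) hz _] := hA x; apply: leq_trans (ltnW hz).
  apply: (@card_in_le _ _ _ _ (fun f => f @! l.+1)).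
    move=> f g; rewrite !inE => /andP[/andP[/colF hf _] /eqP[f1 f2]].
    move=> /andP[/andP[/colF hg _] /eqP[g1 g2]] E.
    by apply: (@coloured_inj 0); rewrite ?add0n ?f1 ?f2 ?g1 ?g2.
  by move=> f; rewrite !inE add0n => /andP[/andP[_ h] /eqP[<- <-]].
have wrap (f : {ffun 'I_m -> V}) : f @! (l.+1 + l) = f @! 0.
  by rewrite -(at_posDm m_gt0 f 0); congr (at_pos m_gt0 f _); rewrite /m; lia.
have h2 : #|F :\: FA| <= #|ends l.+1| * C.
  apply: (@card_fiber_le _ _ _ _ (fun f => (f @! l.+1, f @! (l.+1 + l)))).
    by move=> f; rewrite inE => /andP[_ hf]; apply: (imset_f (fun f => (f @! l.+1, f @! (l.+1 + l)))).
  move=> [y x] _; have [_ _ /(_ y) hz] := hA x; apply: leq_trans (ltnW hz).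
  apply: (@card_in_le _ _ _ _ (fun f => f @! l)).
    move=> f g; rewrite !inE => /andP[/andP[_ /colF hf] /eqP[f1 f2]].
    move=> /andP[/andP[_ /colF hg] /eqP[g1 g2]] E; rewrite !wrap in f2 g2.
    by apply: (@coloured_inj 0); rewrite ?add0n ?f1 ?f2 ?g1 ?g2.
  move=> f; rewrite inE => /andP[+ /eqP[f1 f2]]; rewrite wrap in f2.
  rewrite 2!inE => /andP[hN hf]; rewrite 2!inE -f1 -f2.
  by rewrite [X in _ && X](coloured_frontier 0 (colF _ hf)) andbT; move: hN; rewrite hf.
have := cardsID FA F; have := subset_leq_card (subsetIr F FA).
have := leq_mul (hends 0) (leqnn C); have := leq_mul (hends l.+1) (leqnn C).
have -> : 2 * C * #|V| * D ^ l = 2 * (#|V| * D ^ l * C) by lia.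
lia.
Qed.

Lemma card_coloured D : 0 < D -> #|V| <= D ^ l.+1 ->
  #|coloured| <= 2 ^ m * (6 * C * C) * (#|V| * D ^ l).
Proof.
move=> D0 hD; set X := #|V| * D ^ l.
have hC : 0 < C by rewrite /C addn2.
(* Here [s] counts the positions still to be treated, each of which splits a family in two. The
   summand [4 * C * C * X] on the left absorbs the cycles discarded at each split. *)
have main s F : s <= m -> F \subset coloured ->
    (forall j, s <= j < m -> forall v, #|fwd F j v| <= D) ->
    #|F| + 4 * C * C * X <= 2 ^ s * (6 * C * C) * X.
  elim: s F => [|s IH] F hs sF hd.
    have : #|F| <= 2 * C * X.
      rewrite /X mulnA; apply: card_bounded_fwd => // j v.
      have -> : fwd F j v = fwd F (j %% m) v.
        rewrite /fwd; have -> : [set f in F | f @! j == v] = [set f in F | f @! (j %% m) == v].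
          by apply/setP=> f; rewrite !inE (@at_pos_eq _ _ _ _ j (j %% m)) // modn_mod.
        by apply: eq_imset => f; apply: at_pos_eq; rewrite -addn1 -[in RHS]addn1 modnDml.
      by apply: hd; rewrite ltn_pmod.
    have : 2 * C * X <= 2 * C * C * X.
      by rewrite -!mulnA leq_mul2l /= leq_mul2l [X in _ || X]leq_pmull ?orbT.
    rewrite expn0 mul1n.
    have -> : 4 * C * C * X = 2 * (2 * C * C * X) by lia.
    have -> : 6 * C * C * X = 3 * (2 * C * C * X) by lia.
    lia.
  (* With this [r], position [r + l] is [s] modulo [m], so the edge opposite to [r] starts at
     [s]. *)
  pose r := s + l.+1; have [A hA] := frontier_split r.
  have [F1 [F2 [s1 s2 d1 d2 hF]]] := step_fwd D0 hD sF hA.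
  have rl : r + l = s + m by rewrite /r /m; lia.
  have fwdm (E : {set {ffun 'I_m -> V}}) v : fwd E (r + l) v = fwd E s v.
    rewrite rl /fwd -addSn; have -> : [set f in E | f @! (s + m) == v] = [set f in E | f @! s == v].
      by apply/setP=> f; rewrite !inE at_posDm.
    by apply: eq_imset => f; rewrite at_posDm.
  have rec (E : {set {ffun 'I_m -> V}}) : E \subset F -> (forall v, #|fwd E (r + l) v| <= D) ->
      #|E| + 4 * C * C * X <= 2 ^ s * (6 * C * C) * X.
    move=> sE dE; apply: IH; [exact: ltnW | exact: subset_trans sE sF |].
    move=> j hj v; have [<-|nj] := eqVneq s j; first by rewrite -fwdm.
    by apply: leq_trans (fwd_sub _ _ sE) (hd _ _ _); lia.
  have := rec _ s1 d1; have := rec _ s2 d2; move: hF.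
  rewrite -[4 * C * C * #|V| * _]mulnA -/X expnS -!mulnA; lia.
have := main m coloured (leqnn m) (subxx _).
move/(_ ltac:(move=> j; lia)); apply: leq_trans; exact: leq_addr.
Qed.

End ColouredCycles.

(** * From coloured cycles to all cycles *)

Lemma has_cycle_cyc n m (g : {set 'I_n * 'I_n}) : 0 < m ->
  cyc (fun x y => (x, y) \in g) m -> has_cycle m g.
Proof.
move=> m0 [h [hi he hl]]; apply/existsP; exists [ffun i : 'I_m => h i].
apply/andP; split.
  by apply/injectiveP=> i j; rewrite !ffunE => /hi h2; apply/val_inj/h2.
apply/forallP=> i; rewrite !ffunE /=; have := ltn_ord i.
rewrite leq_eqVlt => /orP[/eqP im|im]; last by rewrite modn_small //; apply: he.
by rewrite im modnn; have -> : nat_of_ord i = m.-1 by lia.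
Qed.

Section Averaging.
Variables (V : finType) (m : nat).
Implicit Types (f : {ffun 'I_m -> V}) (c : {ffun V -> 'I_m}).

Definition compatible f c := [forall i, c (f i) == i].

(** Recolouring the vertices of [f] turns any colouring into a compatible one, and only the old
    colours on [f] are lost. *)
Lemma card_compatible f : injective f ->
  #|{ffun V -> 'I_m}| <= #|[set c | compatible f c]| * #|{ffun 'I_m -> 'I_m}|.
Proof.
move=> fi; rewrite -cardsT.
pose fix_ c := [ffun v => if [pick i | f i == v] is Some i then i else c v].
apply: (@card_fiber_le _ _ _ _ fix_) => [c _|c' _].
  rewrite inE; apply/forallP=> i; rewrite ffunE.
  by case: pickP => [j /eqP/fi -> //|/(_ i)]; rewrite eqxx.
rewrite -[X in _ <= X]cardsT.
apply: (@card_in_le _ _ _ _ (fun c => [ffun i => c (f i)])) => [c1 c2|c]; last by rewrite inE.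
rewrite !inE /= => /eqP e1 /eqP e2 E; apply/ffunP=> v.
have : fix_ c1 v = fix_ c2 v by rewrite e1 e2.
rewrite !ffunE; case: pickP => // i /eqP <- _.
by move/ffunP: E => /(_ i); rewrite !ffunE.
Qed.

Lemma averaging (S : {set {ffun 'I_m -> V}}) B : 0 < m ->
  (forall f, f \in S -> injective f) ->
  (forall c, #|[set f in S | compatible f c]| <= B) ->
  #|S| <= #|{ffun 'I_m -> 'I_m}| * B.
Proof.
move=> m0 Si hB.
pose P := [set fc : {ffun 'I_m -> V} * {ffun V -> 'I_m} |
  (fc.1 \in S) && compatible fc.1 fc.2].
have hN : 0 < #|{ffun V -> 'I_m}| by rewrite card_ffun expn_gt0 card_ord m0.
have h1 : #|P| <= #|{ffun V -> 'I_m}| * B.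
  rewrite -cardsT; apply: (@card_fiber_le _ _ _ _ snd) => [a|c _]; first by rewrite inE.
  apply: leq_trans (hB c).
  apply: (@card_in_le _ _ _ _ fst) => [[f1 c1] [f2 c2]|[f1 c1]]; rewrite !inE /=.
    by move=> /andP[_ /eqP->] /andP[_ /eqP->] ->.
  by case/andP=> /andP[-> h] /eqP <-.
have h2 : #|S| * #|{ffun V -> 'I_m}| <= #|P| * #|{ffun 'I_m -> 'I_m}|.
  rewrite (card_fibers P fst) big_distrl /= -sum_nat_const.
  rewrite [X in _ <= X](bigID (mem S)) /=; apply: leq_trans (leq_addr _ _).
  apply: leq_sum => f fS; apply: leq_trans (card_compatible (Si f fS)) _.
  rewrite leq_mul2r; apply/orP; right.
  apply: (@card_in_le _ _ _ _ (fun c => (f, c))) => [c1 c2 _ _ []//|c].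
  by rewrite !inE /= fS eqxx => ->.
rewrite -(leq_pmul2r hN); apply: leq_trans h2 _.
apply: leq_trans (leq_mul h1 (leqnn _)) _.
by move: #|{ffun V -> 'I_m}| #|{ffun 'I_m -> 'I_m}| => x y; lia.
Qed.

End Averaging.

(** Each cycle subgraph comes from an embedding, and embeddings compatible with a colouring are
    [coloured]; averaging over colourings costs the factor [m ^ m]. *)
Lemma num_cycles_upper n l k D (g : {set 'I_n * 'I_n}) : 1 < l -> l < k ->
  simple_graph g -> free_of l k g -> 0 < D -> n <= D ^ l.+1 ->
  num_cycles (2 * l + 1) g <= (2 * l + 1) ^ (2 * l + 1) *
    (2 ^ (2 * l + 1) * (6 * (2 * k + 2) * (2 * k + 2)) * (n * D ^ l)).
Proof.
move=> hl hk /andP[/forallP girr /forallP gsym] /forallP gfree D0 hD.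
set m := 2 * l + 1.
have m_gt0 : 0 < m by rewrite /m addn1.
pose e x y := (x, y) \in g.
have esym : symmetric e.
  have gs x y : (x, y) \in g -> (y, x) \in g.
    by move: (gsym x) => /forallP/(_ y)/implyP.
  by move=> x y; apply/idP/idP; apply: gs.
have nocyc d : 2 < 2 * d <= 2 * k -> forbidden l k (2 * d) -> ~ cyc e (2 * d).
  move=> hd hf /has_cycle_cyc => /(_ ltac:(lia)).
  have hlt : 2 * d < (2 * k).+1 by lia.
  by move: (gfree (Ordinal hlt)) => /implyP/(_ hf)/negP.
have no_short d : 1 < d <= l -> ~ cyc e (2 * d).
  by move=> hd; apply: nocyc; rewrite /forbidden; lia.
have no_long : ~ cyc e (2 * k).
  by apply: nocyc; rewrite /forbidden ?eqxx ?orbT //; lia.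
apply: leq_trans (leq_imset_card _ _) _.
have -> : m ^ m = #|{ffun 'I_m -> 'I_m}| by rewrite card_ffun card_ord.
rewrite -[X in X <= _]cardsE; apply: averaging => //.
  by move=> f; rewrite inE => /andP[/injectiveP].
move=> c.
have := card_coloured esym hl hk no_short no_long (fun v => c v) D0.
rewrite card_ord => /(_ hD); apply: leq_trans.
apply: subset_leq_card; apply/subsetP=> f; rewrite !inE => /andP[/andP[_ /forallP h1] /forallP h2].
by apply/forallP=> i; rewrite /e h1 (eqP (h2 i)) eqxx.
Qed.

Lemma ex_odd_cycle_upper n l k D : 1 < l -> l < k -> 0 < D -> n <= D ^ l.+1 ->
  ex_odd_cycle l k n <= (2 * l + 1) ^ (2 * l + 1) *
    (2 ^ (2 * l + 1) * (6 * (2 * k + 2) * (2 * k + 2)) * (n * D ^ l)).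
Proof.
move=> hl hk D0 hD; apply/bigmax_leqP=> g /andP[gs gf].
exact: num_cycles_upper.
Qed.

(** * Lower bound *)

Section AddCycle.
Variables (n l k Delta : nat).
Hypotheses (l_gt1 : 1 < l) (l_lt_k : l < k).
Let m := 2 * l + 1.
Let m_gt0 : 0 < m. Proof. by rewrite /m addn1. Qed.
Implicit Types g : {set 'I_n * 'I_n}.

Definition nbrs g x := [set y | (x, y) \in g].

Fixpoint ball g i x : {set 'I_n} :=
  if i is j.+1 then \bigcup_(y in ball g j x) (y |: nbrs g y) else [set x].

Lemma card_ball g i x : (forall y, #|nbrs g y| <= Delta) -> #|ball g i x| <= Delta.+1 ^ i.
Proof.
move=> hd; elim: i => [|i IH] /=; first by rewrite cards1.
apply: leq_trans (_ : \sum_(y in ball g i x) Delta.+1 <= _); last first.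
  by rewrite sum_nat_const expnSr leq_mul2r IH orbT.
have := leq_card_setU; elim/big_ind2: _ => [|n1 B1 n2 B2 h1 h2 hU|y _ _] //.
- by rewrite cards0.
- by apply: leq_trans (hU _ _ _) _; apply: leq_add; [apply: h1 | apply: h2].
- by rewrite cardsU1 -add1n; apply: leq_add (hd y); apply: leq_b1.
Qed.

Lemma ball_walk g h a i : (forall j, j < i -> (h (a + j), h (a + j).+1) \in g) ->
  h (a + i) \in ball g i (h a).
Proof.
elim: i => [|i IH] hg /=; first by rewrite addn0 set11.
apply/bigcupP; exists (h (a + i)); first by apply: IH => j hj; apply: hg; lia.
by rewrite !inE addnS hg ?orbT.
Qed.

Lemma ball_walk_rev g h a i : (forall x y, (x, y) \in g -> (y, x) \in g) ->
  (forall j, j < i -> (h (a + j), h (a + j).+1) \in g) ->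
  h a \in ball g i (h (a + i)).
Proof.
move=> gs hg; pose h' j := h (a + i - j).
have -> : h a = h' (0 + i) by rewrite /h'; congr h; lia.
have -> : h (a + i) = h' 0 by rewrite /h'; congr h; lia.
apply: ball_walk => j hj; apply: gs; rewrite /h'.
have := hg (i - j.+1) ltac:(lia).
have -> : (a + (i - j.+1)).+1 = a + i - (0 + j) by lia.
by have -> : a + (i - j.+1) = a + i - (0 + j).+1 by lia.
Qed.

Lemma ball_mono g i j x : i <= j -> ball g i x \subset ball g j x.
Proof.
move/subnKC <-; elim: (j - i) => [|d IH]; first by rewrite addn0.
apply: subset_trans IH _; rewrite addnS /=; apply/subsetP=> y hy.
by apply/bigcupP; exists y => //; rewrite !inE eqxx.
Qed.

(** Greedy choice: the balls around the points chosen so far do not cover [L]. *)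
Lemma far_points g (L : {set 'I_n}) t : (forall y, #|nbrs g y| <= Delta) ->
  t * Delta.+1 ^ (2 * k) < #|L| -> exists y : nat -> 'I_n,
    (forall i, i <= t -> y i \in L) /\
    (forall i j, i < j -> j <= t -> y j \notin ball g (2 * k) (y i)).
Proof.
move=> hd; elim: t => [|t IH] ht.
  have /card_gt0P[x hx] : 0 < #|L| by apply: leq_ltn_trans ht.
  by exists (fun _ => x); split=> // i j; lia.
have [|y [y1 y2]] := IH; first by move: ht; rewrite mulSn; lia.
pose U := \bigcup_(i : 'I_t.+1) ball g (2 * k) (y i).
have hU : #|U| <= t.+1 * Delta.+1 ^ (2 * k).
  apply: leq_trans (_ : \sum_(i : 'I_t.+1) Delta.+1 ^ (2 * k) <= _); last first.
    by rewrite sum_nat_const card_ord.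
  have := leq_card_setU; rewrite /U; elim/big_ind2: _ => [|n1 B1 n2 B2 h1 h2 hU|i _ _].
  - by rewrite cards0.
  - by apply: leq_trans (hU _ _ _) _; apply: leq_add; [apply: h1 | apply: h2].
  - exact: card_ball.
have [x xL xU] : exists2 x, x \in L & x \notin U.
  apply/subsetPn; apply/negP=> sLU; have h := subset_leq_card sLU.
  by have := leq_trans ht (leq_trans h hU); rewrite ltnn.
exists (fun i => if i <= t then y i else x); split=> [i hi|i j hij hj].
  by case: ifP => // h; apply: y1.
have hit : i < t.+1 by lia.
rewrite (hit : i <= t); case: (leqP j t) => hjt; first exact: y2.
apply: contra xU => h; apply/bigcupP.
by exists (Ordinal hit).
Qed.

(** * Adding a cycle on vertices far apart *)

Section NewCycle.
Variables (g : {set 'I_n * 'I_n}) (y : nat -> 'I_n).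
Hypothesis gsym : forall u v, (u, v) \in g -> (v, u) \in g.
Hypothesis y_far : forall i j, i < j -> j < m -> y j \notin ball g (2 * k) (y i).

Let y0 : {ffun 'I_m -> 'I_n} := [ffun i : 'I_m => y i].
Let Y := at_pos m_gt0 y0.

Definition new_edges := [set uv : 'I_n * 'I_n | [exists i : 'I_m,
  (uv == (y0 i, y0 (ordS i))) || (uv == (y0 (ordS i), y0 i))]].

Let YE i : Y i = y (i %% m).
Proof. by rewrite /Y /at_pos ffunE. Qed.

Lemma new_edgesP u v : (u, v) \in new_edges ->
  exists i, u = Y i /\ v = Y i.+1 \/ u = Y i.+1 /\ v = Y i.
Proof.
have h (i : 'I_m) : y0 i = Y i /\ y0 (ordS i) = Y i.+1.
  split; first by rewrite /Y at_posE.
  by rewrite YE ffunE.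
rewrite inE => /existsP[i]; have [-> ->] := h i.
by case/orP=> /eqP[-> ->]; exists i; [left | right].
Qed.

Lemma new_edges_sym u v : (u, v) \in new_edges -> (v, u) \in new_edges.
Proof.
by rewrite !inE => /existsP[i /orP[/eqP[-> ->]|/eqP[-> ->]]]; apply/existsP; exists i;
  rewrite eqxx ?orbT.
Qed.

Lemma ball_refl i x : x \in ball g i x.
Proof. by apply: (subsetP (ball_mono g x (leq0n i))); rewrite set11. Qed.

Lemma Y_near_eq i j : Y j \in ball g (2 * k) (Y i) -> Y i \in ball g (2 * k) (Y j) ->
  i = j %[mod m].
Proof.
rewrite !YE => h1 h2; case: (ltngtP (i %% m) (j %% m)) => // hij.
  by rewrite (negPf (y_far hij (ltn_pmod j m_gt0))) in h1.
by rewrite (negPf (y_far hij (ltn_pmod i m_gt0))) in h2.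
Qed.

Lemma Y_inj i j : Y i = Y j -> i = j %[mod m].
Proof. by move=> h; apply: Y_near_eq; rewrite h ball_refl. Qed.

Lemma Y_mod i j : i = j %[mod m] -> Y i = Y j.
Proof. exact: at_pos_eq. Qed.

Lemma YS i j : Y i = Y j -> Y i.+1 = Y j.+1.
Proof.
move/Y_inj=> h; apply: Y_mod.
by rewrite -addn1 -[in RHS]addn1 -modnDml h modnDml.
Qed.

Lemma YP i j : Y i.+1 = Y j.+1 -> Y i = Y j.
Proof.
move/Y_inj/eqP; rewrite -addn1 -[in X in _ == X]addn1 eqn_modDr => /eqP.
exact: Y_mod.
Qed.

(** A short walk of old edges puts each end in the ball of the other, so two new vertices joined by
    it coincide. *)
Lemma far_walk h a q i j : q <= 2 * k -> h a = Y i -> h (a + q) = Y j ->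
  (forall t, t < q -> (h (a + t), h (a + t).+1) \in g) -> h a = h (a + q).
Proof.
move=> hq hi hj hg; rewrite hi hj; apply: Y_mod; apply: Y_near_eq.
  rewrite -hi -hj; apply: (subsetP (ball_mono _ _ hq)); exact: ball_walk.
rewrite -hi -hj; apply: (subsetP (ball_mono _ _ hq)); exact: ball_walk_rev.
Qed.

Lemma new_edges_notin u v : (u, v) \in new_edges -> (u, v) \notin g.
Proof.
have N i : (Y i, Y i.+1) \notin g.
  apply/negP=> h; pose w t := if t == 0 then Y i else Y i.+1.
  have : w 0 = w (0 + 1).
    by apply: (@far_walk w 0 1 i i.+1) => //; [lia | case].
  rewrite /w /= => /Y_inj/eqP; rewrite -{1}(addn0 i) -addn1 eqn_modDl.
  by rewrite mod0n modn_small // /m; lia.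
move/new_edgesP=> [i [[-> ->]|[-> ->]]] //.
by apply/negP=> /gsym; apply/negP.
Qed.

(* The set of indices i with Y i on the cycle is closed under successor. *)
Lemma new_cycle_long h M : 2 < M ->
  (forall s t, h s = h t -> s = t %[mod M]) -> (forall t, h (t + M) = h t) ->
  (forall t, (h t, h t.+1) \in new_edges) -> m <= M.
Proof.
move=> hM hinj hper hnew.
(* The two neighbours of [Y i] along [h] are distinct because [M > 2], so they cannot both be its
   predecessor in the new cycle. *)
have hS i t : h t = Y i -> exists s, h s = Y i.+1.
  wlog ht : t / 0 < t.
    by move=> W hti; apply: (W (t + M)); [lia | rewrite hper].
  case: t ht => // t _ hti.
  have [i1 h1] : exists j, h t = Y j /\ (Y j.+1 = Y i \/ Y j = Y i.+1).
    have [j [[a b]|[a b]]] := new_edgesP (hnew t).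
      by exists j; split=> //; left; rewrite -b.
    by exists j.+1; split=> //; right; apply: YS; rewrite -b.
  have [i2 h2] : exists j, h t.+2 = Y j /\ (Y j.+1 = Y i \/ Y j = Y i.+1).
    have [j [[a b]|[a b]]] := new_edgesP (hnew t.+1).
      by exists j.+1; split=> //; right; apply: YS; rewrite -a.
    by exists j; split=> //; left; rewrite -a.
  case: h1 h2 => h1 [e1|e1] [h2 [e2|e2]].
  - have : h t = h t.+2 by rewrite h1 h2; apply: YP; rewrite e1 e2.
    move/hinj/eqP; rewrite -{1}(addn0 t) -addn2 eqn_modDl mod0n modn_small //.
  - by exists t.+2; rewrite h2.
  - by exists t; rewrite h1.
  - by exists t; rewrite h1.
have [i0 [t0 h0]] : exists i t, h t = Y i.
  by have [i [[a _]|[a _]]] := new_edgesP (hnew 0); [exists i, 0 | exists i.+1, 0].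
have hall d : exists t, h t = Y (i0 + d).
  elim: d => [|d [t ht]]; first by exists t0; rewrite addn0.
  by rewrite addnS; apply: hS ht.
have M0 : 0 < M by lia.
have hex (d : 'I_m) : exists t : 'I_M, h t = Y (i0 + d).
  have [t ht] := hall d; exists (Ordinal (ltn_pmod t M0)) => /=; rewrite -ht.
  rewrite {2}(divn_eq t M); elim: (t %/ M) => [|q IH]; first by rewrite mul0n.
  by rewrite IH mulSn [M + _]addnC -addnA [M + _]addnC addnA hper.
have [F hF] := fin_all_exists hex.
have Finj : injective F.
  move=> d d' E; apply/val_inj/eqP => /=.
  have /Y_inj/eqP : Y (i0 + d) = Y (i0 + d') by rewrite -!hF E.
  by rewrite eqn_modDl !modn_small.
by have := leq_card F Finj; rewrite !card_ord.
Qed.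

(** A cycle with only old edges lies in [g]; one with only new edges has length [m], which is not
    forbidden; a mixed one would contain a short old path between two distinct new vertices. *)
Lemma no_new_cycle M : 2 < M <= 2 * k -> forbidden l k M ->
  ~~ has_cycle M g -> ~~ has_cycle M (g :|: new_edges).
Proof.
move=> hM hf; apply: contra => /existsP[f /andP[/injectiveP fi /forallP fe]].
have M0 : 0 < M by lia.
pose h := at_pos M0 f.
have hinj s t : h s = h t -> s = t %[mod M] by move/fi=> [].
have hper t : h (t + M) = h t by apply: at_posDm.
have hE t : ((h t, h t.+1) \in g) || ((h t, h t.+1) \in new_edges).
  by have := fe (Ordinal (ltn_pmod t M0)); rewrite inE /h at_posS.
have hperq q t : h (t + q * M) = h t.
  by elim: q => [|q IH]; rewrite ?addn0 // mulSn addnCA addnC hper.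
case: (boolP [forall t : 'I_M, (h t, h t.+1) \in g]) => [/forallP hall|].
  apply/existsP; exists f; apply/andP; split; first exact/injectiveP.
  apply/forallP=> t; have := hall t; rewrite /h at_posE.
  by rewrite at_posS; congr ((_, f (ordS _)) \in g); apply: val_inj; rewrite /= modn_small.
case/forallPn=> t0 ht0.
case: (boolP [exists t : 'I_M, (h t, h t.+1) \in g]) => [/existsP[t1 ht1]|]; last first.
  move/existsPn=> hN.
  have hnew t : (h t, h t.+1) \in new_edges.
    have := hN (Ordinal (ltn_pmod t M0)) => /=.
    have -> : h (t %% M) = h t by apply: at_pos_eq; rewrite modn_mod.
    have -> : h (t %% M).+1 = h t.+1.
      by apply: at_pos_eq; rewrite -addn1 -[in RHS]addn1 modnDml.
    by move/negPf=> h1; have := hE t; rewrite h1.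
  have mM : m <= M by apply: new_cycle_long hinj hper hnew; lia.
  have : M <= m.
    have hex (t : 'I_M) : exists i : 'I_m, h t = Y i.
      have [i hi] : exists i, h t = Y i.
        by have [i [[a _]|[a _]]] := new_edgesP (hnew t); [exists i | exists i.+1].
      exists (Ordinal (ltn_pmod i m_gt0)); rewrite hi; apply: Y_mod.
      by rewrite /= modn_mod.
    have [F hF] := fin_all_exists hex.
    have Finj : injective F.
      move=> t t' E; apply/val_inj/eqP => /=.
      have /hinj/eqP : h t = h t' by rewrite !hF E.
      by rewrite !modn_small.
    by have := leq_card F Finj; rewrite !card_ord.
  by move: hf mM; rewrite /forbidden /m; lia.
exfalso.
(* a maximal run of old edges joins two of the new vertices *)
pose old t := (h t, h t.+1) \in g.
have oldM t : old (t + M) = old t by rewrite /old -addSn !hper.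
have ex1 : exists t, (t0 < t) && old t.
  by exists (t1 + M); rewrite oldM /old ht1 andbT; have := ltn_ord t0; lia.
case: (ex_minnP ex1) => s /andP[hs olds] smin.
have news : ~~ old s.-1.
  have [->|ne] := eqVneq s.-1 t0; first exact: ht0.
  apply/negP=> ho; have := smin s.-1; rewrite ho andbT; lia.
have ex2 : exists t, (s < t) && ~~ old t.
  by exists (s.-1 + M); rewrite oldM news andbT; lia.
case: (ex_minnP ex2) => r /andP[hr newr] rmin.
(* Hence the run has fewer than [M] edges: its ends are distinct on the cycle, and [far_walk]
   applies. *)
have rM : r <= s.-1 + M by apply: rmin; rewrite oldM news andbT; lia.
have getY t : ~~ old t -> (h t, h t.+1) \in new_edges.
  by move/negPf=> ho; have := hE t; rewrite -/(old t) ho.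
have [i hi] : exists i, h s = Y i.
  have := new_edgesP (getY _ news); have -> : s.-1.+1 = s by lia.
  by case=> i [[_ b]|[_ b]]; [exists i.+1 | exists i].
have [j hj] : exists j, h (s + (r - s)) = Y j.
  have -> : s + (r - s) = r by lia.
  by have [j [[a _]|[a _]]] := new_edgesP (getY _ newr); [exists j | exists j.+1].
have : h s = h (s + (r - s)).
  apply: far_walk hi hj _; first by lia.
  move=> t ht; apply/negPn/negP=> ho.
  case: t ht ho => [|t] ht ho; first by move: ho; rewrite addn0 -/(old s) olds.
  by have := rmin (s + t.+1); rewrite /old ho andbT; lia.
move/hinj/eqP; rewrite -{1}(addn0 s) eqn_modDl mod0n modn_small; lia.
Qed.

Lemma nbrs_new_edges x : #|nbrs new_edges x| <= 2.
Proof.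
have [->|/set0Pn[v]] := eqVneq (nbrs new_edges x) set0; first by rewrite cards0.
have key i : x = Y i -> #|nbrs new_edges x| <= 2.
  move=> xi; apply: leq_trans (_ : #|[set Y i.+1; Y (i + m).-1]| <= 2); last first.
    by rewrite cards2; case: eqP.
  have hp : (i + m).-1.+1 = i + m by move: m_gt0; lia.
  apply: subset_leq_card; apply/subsetP=> u; rewrite inE => /new_edgesP[j [[a b]|[a b]]].
    by rewrite !inE b; apply/orP; left; apply/eqP/YS; rewrite -a.
  rewrite !inE b; apply/orP; right; apply/eqP/YP; rewrite hp -a xi.
  by apply: Y_mod; rewrite modnDr.
rewrite inE => /new_edgesP[i [[xi _]|[xi _]]]; exact: key xi.
Qed.

Lemma nbrs_new_edges0 x : (forall i, i < m -> x <> y i) -> nbrs new_edges x = set0.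
Proof.
move=> hx; apply/setP=> v; rewrite !in_set0; apply/negP; rewrite in_set.
by case/new_edgesP=> i [[xi _]|[xi _]]; move: xi; rewrite YE; apply: hx; rewrite ltn_pmod.
Qed.

Lemma card_new_edges : #|new_edges| <= 2 * m.
Proof.
apply: leq_trans (_ : #|[set (y0 i, y0 (ordS i)) | i : 'I_m] :|:
                        [set (y0 (ordS i), y0 i) | i : 'I_m]| <= _).
  apply: subset_leq_card; apply/subsetP=> uv; rewrite !inE => /existsP[i].
  by case/orP=> /eqP ->; apply/orP; [left | right]; apply: imset_f.
rewrite cardsU; apply: leq_trans (leq_subr _ _) _.
rewrite mul2n -addnn.
by apply: leq_add; rewrite -[X in _ <= X]card_ord; apply: leq_imset_card.
Qed.

(** Old cycles survive, and the new one is not among them since its edges are not in [g]. *)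
Lemma num_cycles_add : num_cycles m g < num_cycles m (g :|: new_edges).
Proof.
have embS f : cycle_emb g f -> cycle_emb (g :|: new_edges) f.
  move=> /andP[fi /forallP fe]; apply/andP; split=> //.
  by apply/forallP=> i; rewrite inE fe.
have emb0 : cycle_emb (g :|: new_edges) y0.
  apply/andP; split; last first.
    by apply/forallP=> i; rewrite !inE; apply/orP; right; apply/existsP; exists i; rewrite eqxx.
  apply/injectiveP=> i j E; apply/val_inj/eqP => /=.
  have /Y_inj/eqP : Y i = Y j by rewrite /Y !at_posE.
  by rewrite !modn_small.
apply: proper_card; apply/properP; split.
  by apply/subsetP=> _ /imsetP[f hf ->]; apply: imset_f; move: hf; rewrite !inE; apply: embS.
exists (cycle_edges y0); first by apply: imset_f; rewrite inE.
apply/negP=> /imsetP[f]; rewrite inE => /andP[_ /forallP fe] E.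
pose i0 := Ordinal m_gt0.
have hnew : (y0 i0, y0 (ordS i0)) \in new_edges.
  by rewrite inE; apply/existsP; exists i0; rewrite eqxx.
have : [set y0 i0; y0 (ordS i0)] \in cycle_edges f by rewrite -E; apply: imset_f.
case/imsetP=> i _ E2.
have h1 : y0 i0 \in [set f i; f (ordS i)] by rewrite -E2 !inE eqxx.
have h2 : y0 (ordS i0) \in [set f i; f (ordS i)] by rewrite -E2 !inE eqxx orbT.
have h3 : f i \in [set y0 i0; y0 (ordS i0)] by rewrite E2 !inE eqxx.
have h4 : f (ordS i) \in [set y0 i0; y0 (ordS i0)] by rewrite E2 !inE eqxx orbT.
have hN := new_edges_notin hnew.
have hN' : (y0 (ordS i0), y0 i0) \notin g by apply: new_edges_notin; apply: new_edges_sym.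
move: h1 h2 h3 h4; rewrite !inE.
case/orP=> /eqP e1; case/orP=> /eqP e2.
- by move=> _; case/orP=> /eqP e3; have := fe i; move: hN hN'; rewrite e1 e2 e3 ?e1 ?e2 => /negPf->.
- by move=> _ _; have := fe i; rewrite -e1 -e2 (negPf hN).
- by move=> _ _; have := fe i; rewrite -e1 -e2 (negPf hN').
- by case/orP=> /eqP e3 _; have := fe i; move: hN hN'; rewrite e1 e2 e3 ?e1 ?e2 => /negPf->.
Qed.

End NewCycle.

(** * Extremal admissible graphs *)

(** In the last condition each cycle pays for its [2 * m] ordered pairs, so that many edges force
    many cycles. *)
Definition admissible g := [&& simple_graph g, free_of l k g,
  [forall x, #|nbrs g x| <= Delta] & #|g| <= 2 * m * num_cycles m g].

Lemma admissible_extend g : admissible g ->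
  m * Delta.+1 ^ (2 * k) < #|[set x | (#|nbrs g x|).+2 <= Delta]| ->
  exists g', admissible g' /\ num_cycles m g < num_cycles m g'.
Proof.
move=> /and4P[/andP[/forallP girr /forallP gsym] /forallP gfree /forallP gdeg gcard] hL.
have gs u v : (u, v) \in g -> (v, u) \in g by move: (gsym u) => /forallP/(_ v)/implyP.
(* Parameter [2 * l] in [far_points] yields [2 * l + 1] points, as many as the cycle needs. *)
have hL' : 2 * l * Delta.+1 ^ (2 * k) < #|[set x | (#|nbrs g x|).+2 <= Delta]|.
  by apply: leq_ltn_trans hL; rewrite leq_mul2r /m addn1 leqnSn orbT.
have [y [yL yfar']] := far_points gdeg hL'.
have yfar i j : i < j -> j < m -> y j \notin ball g (2 * k) (y i).
  by rewrite /m addn1 ltnS; apply: yfar'.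
have hadd := num_cycles_add gs yfar.
exists (g :|: new_edges y); split=> //; apply/and4P; split.
- apply/andP; split; apply/forallP=> u.
    apply/negP; rewrite inE (negPf (girr u)) /= => h.
    have [i [[a b]|[a b]]] := new_edgesP h; move: a; rewrite b => /(Y_inj yfar)/eqP.
      rewrite -{2}(addn0 i) -addn1 eqn_modDl mod0n modn_small // /m; lia.
    rewrite -{1}(addn0 i) -addn1 eqn_modDl mod0n modn_small // /m; lia.
  apply/forallP=> v; apply/implyP; rewrite !in_setU => /orP[/gs ->//|/new_edges_sym ->].
  by rewrite orbT.
- apply/forallP=> M; apply/implyP=> hf; apply: no_new_cycle => //.
    by have := ltn_ord M; move: hf; rewrite /forbidden; lia.
  by have := gfree M; rewrite hf.
- apply/forallP=> x.
  have hU : #|nbrs (g :|: new_edges y) x| <= #|nbrs g x| + #|nbrs (new_edges y) x|.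
    apply: leq_trans (leq_card_setU _ _); apply: subset_leq_card.
    by apply/subsetP=> v; rewrite !in_set.
  apply: leq_trans hU _.
  case: (boolP [exists i : 'I_m, x == y i]) => [/existsP[i /eqP ->]|/existsPn hN].
    have := yL i; rewrite inE => /(_ ltac:(have := ltn_ord i; rewrite /m; lia)).
    by have := nbrs_new_edges yfar (y i); lia.
  rewrite nbrs_new_edges0 ?cards0 ?addn0 // => i hi xi.
  by have := hN (Ordinal hi); rewrite xi eqxx.
- rewrite cardsU; apply: leq_trans (leq_subr _ _) _.
  apply: leq_trans (leq_add gcard (card_new_edges y)) _.
  by rewrite addnC -mulnS leq_mul2l hadd orbT.
Qed.

Lemma admissible_exists : admissible set0.
Proof.
apply/and4P; split.
- by apply/andP; split; apply/forallP=> x; rewrite ?inE //; apply/forallP=> v; rewrite inE.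
- apply/forallP=> M; apply/implyP=> hf; apply/existsPn=> f; apply/negP=> /andP[_ /forallP fe].
  have M0 : 0 < M by move: hf; rewrite /forbidden; lia.
  by have := fe (Ordinal M0); rewrite inE.
- by apply/forallP=> x; rewrite (_ : nbrs _ _ = set0) ?cards0 //; apply/setP=> v; rewrite !inE.
- by rewrite cards0.
Qed.

(** In an admissible graph with the most cycles, [admissible_extend] bounds the number of vertices
    of degree at most [Delta - 2]; all others have degree at least [Delta - 1]. *)
Lemma ex_odd_cycle_lower :
  (n - m * Delta.+1 ^ (2 * k)) * Delta.-1 <= 2 * m * ex_odd_cycle l k n.
Proof.
case: (arg_maxnP (fun g => num_cycles m g) admissible_exists) => g hg gmax.
pose L := [set x | (#|nbrs g x|).+2 <= Delta].
have hL : #|L| <= m * Delta.+1 ^ (2 * k).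
  rewrite leqNgt; apply/negP=> /(admissible_extend hg)[g' [/gmax h1 h2]].
  by move: h1; rewrite /= leqNgt h2.
have /and4P[g1 g2 _ g4] := hg.
apply: leq_trans (_ : #|g| <= _); last first.
  apply: leq_trans g4 _; rewrite leq_mul2l; apply/orP; right.
  by apply: (@leq_bigmax_cond _ _ (fun g => num_cycles (2 * l + 1) g)); rewrite g1.
apply: leq_trans (_ : #|~: L| * Delta.-1 <= _).
  by rewrite leq_mul2r cardsCs card_ord setCK leq_sub2l ?orbT.
apply: (@card_fiber_ge _ _ _ _ fst) => x; rewrite !inE -ltnNge ltnS => hx.
apply: leq_trans (_ : #|nbrs g x| <= _); first by lia.
apply: (@card_in_le _ _ _ _ (fun v => (x, v))) => [u v _ _ []//|v].
by rewrite !inE eqxx andbT.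
Qed.

End AddCycle.

(** * Passing to real exponents *)

Lemma nat_root q n : 0 < q -> exists t, t ^ q <= n < t.+1 ^ q.
Proof.
move=> q0; elim: n => [|n [t /andP[h1 h2]]].
  by exists 0; rewrite exp0n // exp1n.
case: (ltnP n.+1 (t.+1 ^ q)) => h; first by exists t; rewrite (leqW h1).
by exists t.+1; rewrite h (leq_ltn_trans h2) // ltn_exp2r.
Qed.

Lemma ex_odd_cycle_lower_root l k n : 1 < l -> l < k ->
  (2 * (2 * l + 1) + 2) ^ (2 * k + 1) <= n ->
  exists t, n <= t ^ (2 * k + 1) /\ n * t <= 16 * (2 * l + 1) * ex_odd_cycle l k n.
Proof.
set m := 2 * l + 1 => hl hk hn.
have q0 : 0 < 2 * k + 1 by rewrite addn1.
have [t /andP[h1 h2]] := nat_root n q0; exists t.+1; split; first exact: ltnW.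
have ht : 2 * m + 2 <= t.
  by rewrite -ltnS -(ltn_exp2r _ _ q0); apply: leq_ltn_trans h2.
(* With [Delta = t - 1] the exceptional vertices number at most [m * t ^ (2 * k)], which is at most
   half of [n] because [t >= 2 * m + 2]. *)
have := ex_odd_cycle_lower n t.-1 hl hk; rewrite -/m.
have -> : t.-1.+1 = t by lia.
have h3 : 2 * (m * t ^ (2 * k)) <= n.
  by apply: leq_trans h1; rewrite addn1 expnS mulnA leq_mul2r; lia.
set a := n - _ => h4.
have ha : n <= 2 * a by rewrite /a; lia.
have hb : t.+1 <= 4 * t.-2 by lia.
have := leq_mul ha hb; move: h4; move: t.-2 (ex_odd_cycle _ _ _) => b ex; lia.
Qed.

(** Take [D = t + 1] with [t] the integer root of order [l + 1]; the bound [t + 1 <= 2 * t] costs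
    the factor [2 ^ l]. *)
Lemma ex_odd_cycle_upper_root l k : 1 < l -> l < k -> exists K, 0 < K /\
  forall n, 0 < n -> exists t,
    [/\ 0 < t, t ^ l.+1 <= n & ex_odd_cycle l k n <= K * (n * t ^ l)].
Proof.
move=> hl hk; set c := (2 * l + 1) ^ (2 * l + 1) *
  (2 ^ (2 * l + 1) * (6 * (2 * k + 2) * (2 * k + 2))).
exists (c * 2 ^ l); split; first by rewrite !muln_gt0 !expn_gt0 !addn_gt0 /= !orbT.
move=> n n0; have [t /andP[h1 h2]] := nat_root n (ltn0Sn l).
have t0 : 0 < t by case: t h1 h2 => // _; rewrite exp1n; case: n n0.
exists t; split=> //.
apply: leq_trans (ex_odd_cycle_upper hl hk (ltn0Sn t) (ltnW h2)) _.
rewrite mulnA -/c -mulnA leq_mul2l; apply/orP; right.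
rewrite mulnCA leq_mul2l -expnMn; apply/orP; right.
by rewrite leq_exp2r; lia.
Qed.

Lemma INR_expn a b : INR (a ^ b) = pow (INR a) b.
Proof. by elim: b => [|b IH] //=; rewrite expnS -multE mult_INR IH. Qed.

End GenTuran.

(** * Real powers and the asymptotic bounds *)

Open Scope R_scope.

Lemma Rpower_root (x : R) (q : nat) : 0 < x -> q <> 0%nat ->
  Rpower (x ^ q) (1 / INR q) = x.
Proof.
  intros hx hq.
  assert (hq0 : INR q <> 0) by (apply not_0_INR; exact hq).
  rewrite <- Rpower_pow by exact hx.
  rewrite Rpower_mult.
  replace (INR q * (1 / INR q)) with 1 by (field; exact hq0).
  apply Rpower_1; exact hx.
Qed.

Lemma Rpower_root_le (x y : R) (q : nat) : 0 < x -> 0 < y -> q <> 0%nat ->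
  x <= y ^ q -> Rpower x (1 / INR q) <= y.
Proof.
  intros hx hy hq h.
  rewrite <- (Rpower_root y q hy hq) at 1.
  apply Rle_Rpower_l; [|split; assumption].
  apply Rlt_le, Rdiv_lt_0_compat; [exact Rlt_0_1|].
  apply lt_0_INR; apply Nat.neq_0_lt_0; exact hq.
Qed.

Lemma Rpower_root_ge (x y : R) (q : nat) : 0 < y -> q <> 0%nat ->
  y ^ q <= x -> y <= Rpower x (1 / INR q).
Proof.
  intros hy hq h.
  rewrite <- (Rpower_root y q hy hq) at 1.
  apply Rle_Rpower_l; [|split; [apply pow_lt; exact hy | exact h]].
  apply Rlt_le, Rdiv_lt_0_compat; [exact Rlt_0_1|].
  apply lt_0_INR; apply Nat.neq_0_lt_0; exact hq.
Qed.

Theorem theorem13 (k l : nat) (hl : (2 <= l)%nat) (hkl : (l < k)%nat) :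
  (exists c : R, 0 < c /\ exists N : nat, forall n : nat, (N <= n)%nat ->
      c * Rpower (INR n) (1 + 1 / (2 * INR k + 1)) <= INR (ex_odd_cycle l k n)) /\
  (exists C : R, 0 < C /\ exists N : nat, forall n : nat, (N <= n)%nat ->
      INR (ex_odd_cycle l k n) <= C * Rpower (INR n) (1 + INR l / (INR l + 1))).
Proof.
  assert (hl' := ssrbool.introT ssrnat.leP hl : is_true (ssrnat.leq 2 l)).
  assert (hk' := ssrbool.introT ssrnat.leP hkl : is_true (ssrnat.leq (S l) k)).
  split.
  - assert (hm : 0 < INR (16 * (2 * l + 1))) by (apply lt_0_INR; lia).
    exists (/ INR (16 * (2 * l + 1))); split; [apply Rinv_0_lt_compat; exact hm|].
    exists (S (ssrnat.expn (2 * (2 * l + 1) + 2) (2 * k + 1))).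
    intros n hn.
    assert (hn0 : 0 < INR n) by (apply lt_0_INR; lia).
    destruct (GenTuran.ex_odd_cycle_lower_root (n := n) hl' hk') as [t [h1 h2]].
    { apply (ssrbool.introT ssrnat.leP); lia. }
    apply (ssrbool.elimT ssrnat.leP), le_INR in h1, h2.
    rewrite GenTuran.INR_expn in h1.
    change (INR (n * t) <= INR ((16 * (2 * l + 1)) * ex_odd_cycle l k n)) in h2.
    rewrite 2!mult_INR in h2.
    assert (ht : 0 < INR t).
    { destruct (Rle_lt_or_eq_dec 0 (INR t) (pos_INR t)) as [h|h]; [exact h|].
      rewrite <- h, pow_ne_zero in h1 by (unfold ssrnat.addn; lia). lra. }
    (* The power splits as [n] times a root of [n], and [t] bounds that root from above. *)
    rewrite Rpower_plus, Rpower_1 by exact hn0.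
    replace (2 * INR k + 1) with (INR (2 * k + 1)) by (rewrite plus_INR, mult_INR; reflexivity).
    assert (h3 := Rpower_root_le (INR n) (INR t) (2 * k + 1) hn0 ht ltac:(lia) h1).
    apply Rmult_le_reg_l with (1 := hm).
    rewrite <- Rmult_assoc, Rinv_r, Rmult_1_l by lra.
    apply Rle_trans with (2 := h2), Rmult_le_compat_l; lra.
  - destruct (GenTuran.ex_odd_cycle_upper_root hl' hk') as [K [hK hup]].
    exists (INR K); split; [apply lt_0_INR; exact (ssrbool.elimT ssrnat.leP hK)|].
    exists 1%nat; intros n hn.
    assert (hn0 : 0 < INR n) by (apply lt_0_INR; lia).
    destruct (hup n (ssrbool.introT ssrnat.leP hn)) as [t [h0 h1 h2]].
    apply (ssrbool.elimT ssrnat.leP), le_INR in h1, h2.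
    apply (ssrbool.elimT ssrnat.leP), lt_0_INR in h0.
    rewrite GenTuran.INR_expn in h1.
    change (INR (ex_odd_cycle l k n) <= INR (K * (n * ssrnat.expn t l))) in h2.
    rewrite 2!mult_INR, GenTuran.INR_expn in h2.
    apply Rle_trans with (1 := h2), Rmult_le_compat_l; [apply pos_INR|].
    rewrite Rpower_plus, Rpower_1 by exact hn0.
    apply Rmult_le_compat_l; [lra|].
    assert (h3 := Rpower_root_ge (INR n) (INR t) (S l) h0 ltac:(lia) h1).
    (* This makes the power the [l]-th power of the root of order [l + 1], which is at least [t]. *)
    replace (INR l / (INR l + 1)) with (1 / INR (S l) * INR l)
      by (rewrite S_INR; field; assert (h := pos_INR l); lra).
    rewrite <- Rpower_mult, Rpower_pow by (apply exp_pos).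
    apply pow_incr; lra.
Qed.
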